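(* For each integer $n\ge 1$ we have $f(n,9n)\le 2$. Moreover $f(n,9n)\in\Theta(1)$ as $n\to\infty$, i.e. there are constants $c,C>0$ and $n_0\in\mathbb{N}$ with $c\le f(n,9n)\le C$ for all $n\ge n_0$.
   Context: One-dimensional Hegselmann--Krause (HK) system with strategic agents: there is a set $N=\{1,\dots,n\}$ of non-strategic agents and a disjoint set $S$ of $m=|S|$ strategic agents; $A=N\cup S$. At each discrete time $t\in\mathbb{N}_{\ge 0}$ every agent $i\in A$ has an opinion $x_i(t)\in\mathbb{R}$. The starting opinions $x_i(0)$, $i\in N$, are given. The opinions $x_s(t)$ of the strategic agents $s\in S$ can be chosen freely (as any real numbers) at every time $t$. For $i\in N$, $$x_i(t+1)=\frac{1}{|\mathcal{N}_i(t)|}\sum_{j\in\mathcal{N}_i(t)}x_j(t),\qquad \mathcal{N}_i(t)=\{j\in A: |x_i(t)-x_j(t)|\le 1\}.$$ The system has converged at time $t$ if for all $i,j\in N$ either $x_i(t)=x_j(t)$ or $|x_i(t)-x_j(t)|>1$. The convergence time is the smallest $t\in\mathbb{N}_{\ge 0}$ such that the system has converged at time $t$. For given starting opinions of the non-strategic agents and given $m$, the optimal convergence time is the minimum of the convergence time over all choices of the opinions of the $m$ strategic agents at all times. $f(n,m)$ denotes the supremum of the optimal convergence time over all starting opinions of $n$ non-strategic agents, with $m$ strategic agents. *)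

(* Defs.v *)
From mathcomp Require Import all_boot all_order all_algebra.
From mathcomp Require Import all_classical all_reals ereal.
Set Implicit Arguments.
Unset Strict Implicit.
Unset Printing Implicit Defensive.
Import Order.TTheory GRing.Theory Num.Theory.
Local Open Scope ring_scope.

(* A = N \cup S: [inl i] is a non-strategic agent, [inr s] a strategic one. *)
Definition agent (n m : nat) : finType := ('I_n + 'I_m)%type.

Definition profile (R : realType) (n m : nat)
    (x : 'I_n -> R) (s : 'I_m -> R) (a : agent n m) : R :=
  match a with inl i => x i | inr k => s k end.

Definition neighbors (R : realType) (n m : nat)
    (y : agent n m -> R) (a : agent n m) : {set agent n m} :=
  [set b | `|y a - y b| <= 1]%SET.

Definition hk_step (R : realType) (n m : nat)
    (x : 'I_n -> R) (s : 'I_m -> R) (i : 'I_n) : R :=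
  let y := profile x s in
  (#|neighbors y (inl i)|%:R)^-1 * \sum_(b in neighbors y (inl i)) y b.

(* Opinions of the non-strategic agents; [s t k] is the freely chosen opinion
   of the strategic agent [k] at time [t].  The dynamics is deterministic, so
   fixing the whole schedule [s] in advance loses no generality. *)
Fixpoint hk_traj (R : realType) (n m : nat)
    (x0 : 'I_n -> R) (s : nat -> 'I_m -> R) (t : nat) : 'I_n -> R :=
  match t with
  | 0%N => x0
  | t'.+1 => hk_step (hk_traj x0 s t') (s t')
  end.

Definition converged (R : realType) (n : nat) (x : 'I_n -> R) : Prop :=
  forall i j : 'I_n, x i = x j \/ 1 < `|x i - x j|.

(* The times below live in the extended reals.  Infima are taken over sets of
   elements of N \cup {+oo}, so they are minima (and +oo if the set is empty,
   i.e. if the system never converges). *)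
Definition convergence_time (R : realType) (n m : nat)
    (x0 : 'I_n -> R) (s : nat -> 'I_m -> R) : \bar R :=
  ereal_inf [set (t%:R)%:E | t in [set t : nat | converged (hk_traj x0 s t)]]%classic.

Definition optimal_convergence_time (R : realType) (n : nat)
    (x0 : 'I_n -> R) (m : nat) : \bar R :=
  ereal_inf [set convergence_time x0 s | s in [set: nat -> 'I_m -> R]]%classic.

Definition f (R : realType) (n m : nat) : \bar R :=
  ereal_sup
    [set optimal_convergence_time x0 m | x0 in [set: 'I_n -> R]]%classic.

(* Main.v *)
Require Import Defs.
From mathcomp Require Import all_boot all_order all_algebra.
From mathcomp Require Import all_classical all_reals ereal.
From mathcomp Require Import zify ring lra.
Set Implicit Arguments.
Unset Strict Implicit.
Unset Printing Implicit Defensive.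
Import Order.TTheory GRing.Theory Num.Theory.
Local Open Scope ring_scope.

(* Choose [theta] so that no opinion lies on [theta + 2Z], and call the cell of
   an agent the interval of length 2 between consecutive points of this grid
   that contains it.  An agent sees the centre of its own cell and no other
   centre, and sees agents of its own and of the two adjacent cells only.  Each
   agent places three strategic agents at the centre of its own cell and of both
   adjacent ones, at all times.  Relative to the centre p of the cell of an agent
   i, each visible agent y weighs 2|y - p| - 1, which is -1 for a strategic
   agent at p, at most 1 for an agent of the cell and at most 3 for one of an
   adjacent cell; so the weights add up to a negative number, i.e. i moves
   to within 1/2 of p.  Now two agents see each other iff they share their cell,
   and the second step merges every cell. *)

Lemma neighbors_gt0 (R : realType) (n m : nat) (y : agent n m -> R)
    (a : agent n m) : (0 < #|neighbors y a|)%N.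
Proof. by apply/card_gt0P; exists a; rewrite inE subrr normr0 ler01. Qed.

Lemma sub_hk_step (R : realType) (n m : nat) (x : 'I_n -> R) (s : 'I_m -> R)
    (i : 'I_n) (p : R) (N := neighbors (profile x s) (inl i)) :
  hk_step x s i - p = #|N|%:R^-1 * \sum_(b in N) (profile x s b - p).
Proof.
have N0 : #|N|%:R != 0 :> R by rewrite pnatr_eq0 -lt0n neighbors_gt0.
by rewrite /hk_step -/N sumrB sumr_const -mulr_natl; field.
Qed.

(** By the triangle inequality the mean deviation from [p] is at most the mean distance to [p],
    which the hypothesis puts below 1/2. *)
Lemma hk_step_near (R : realType) (n m : nat) (x : 'I_n -> R) (s : 'I_m -> R)
    (i : 'I_n) (p : R) :
  \sum_(b in neighbors (profile x s) (inl i)) (2 * `|profile x s b - p| - 1) < 0 ->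
  `|hk_step x s i - p| < 2^-1.
Proof.
rewrite sub_hk_step sumrB -mulr_sumr sumr_const.
set N := neighbors _ _; set S := \sum_(b in N) `|_|; move=> ltS.
have N0 : 0 < #|N|%:R :> R by rewrite ltr0n neighbors_gt0.
rewrite normrM gtr0_norm ?invr_gt0// ltr_pdivrMl//.
apply: le_lt_trans (ler_norm_sum _ _ _) _; rewrite -/S.
lra.
Qed.

(* The centre of the cell between [theta + 2k] and [theta + 2k + 2]. *)
Definition grid (R : realType) (theta : R) (k : int) : R :=
  theta + 2 * k%:~R + 1.

Lemma grid_sep (R : realType) (theta : R) (k l : int) :
  k != l -> 2 <= `|grid theta k - grid theta l|.
Proof.
move=> kl; have -> : grid theta k - grid theta l = 2 * (k - l)%:~R.
  by rewrite /grid rmorphB /=; ring.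
have : 1 <= `|(k - l)%:~R : R|.
  by rewrite -intr_norm -[1]/(1%:~R) ler_int; lia.
by rewrite normrM gtr0_norm//; lra.
Qed.

Lemma near_grid_sep (R : realType) (theta : R) (k l : int) (u v : R) :
  `|u - grid theta k| < 2^-1 -> `|v - grid theta l| < 2^-1 ->
  (`|u - v| <= 1) = (k == l).
Proof.
move=> uk vl; case: eqVneq => [kl|/(@grid_sep R theta)].
  by move: uk vl; rewrite kl !ltr_norml; rewrite ler_norml; lra.
have := ler_distD u (grid theta k) (grid theta l).
have := ler_distD v u (grid theta l).
rewrite (distrC (grid theta k) u) => ? ? ?; case: leP => // ?; exfalso; lra.
Qed.

(* Pigeonhole: among n + 1 offsets that are distinct mod 2, each opinion rules
   out at most one. *)
Lemma grid_avoid (R : realType) (n : nat) (x : 'I_n -> R) :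
  exists (theta : R) (g : 'I_n -> int), forall i, `|x i - grid theta (g i)| < 1.
Proof.
pose th (c : 'I_n.+1) : R := 2 * (c%:R / n.+1%:R).
have [[c hc]|bad] := pselect (exists c, forall i, forall k : int,
    x i != th c + 2 * k%:~R).
  exists (th c), (fun i => Num.floor ((x i - th c) / 2)) => i.
  have := floor_itv ((x i - th c) / 2); set k := Num.floor _.
  rewrite rmorphD rmorph1 /= => /andP[h1 h2]; have := hc i k.
  rewrite /grid neq_lt ltr_norml; move: h1 h2.
  by move=> h1 h2 /orP[] h3; apply/andP; split; lra.
have /choice [F FE] : forall c : 'I_n.+1,
    exists i, exists k : int, x i = th c + 2 * k%:~R.
  move=> c; apply: contrapT => h; apply: bad; exists c => i k.
  by apply/eqP => e; apply: h; exists i, k.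
suff /leq_card : injective F by rewrite !card_ord ltnn.
move=> c d Fcd; have [k hk] := FE c; have [l hl] := FE d.
have e : (c%:R - d%:R : R) = (l - k)%:~R * n.+1%:R.
  have n0 : n.+1%:R != 0 :> R by rewrite pnatr_eq0.
  have : c%:R / n.+1%:R - d%:R / n.+1%:R = (l - k)%:~R :> R.
    by rewrite rmorphB /=; move: hk; rewrite Fcd hl /th; move: (_ / _) (_ / _) => a b; lra.
  by move <-; field.
have {}e : (c%:Z - d%:Z) = (l - k) * n.+1%:Z.
  by apply/eqP; rewrite -(eqr_int R) rmorphM rmorphB /= -!pmulrn e.
apply/val_inj => /=; have := ltn_ord c; have := ltn_ord d => hd hc.
(* Both [c] and [d] lie in [0, n], so their difference is a multiple of n + 1 only if it is 0. *)
have [h|[h|h]] : l - k = 0 \/ l - k >= 1 \/ l - k <= -1 by lia.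
- lia.
- nia.
- nia.
Qed.

(** Serves to group the strategic agents by the agent [j] that places them. *)
Lemma sum_mxvec_index (V : nmodType) (m n : nat) (G : 'I_(m * n) -> V) :
  \sum_k G k = \sum_(j < n) \sum_(r < m) G (mxvec_index r j).
Proof.
rewrite exchange_big pair_bigA /=.
rewrite (reindex (uncurry (@mxvec_index m n))) /=; last exact: curry_mxvec_bij.
by apply: eq_bigr => -[].
Qed.

(** Each of the cells [k - 1], [k], [k + 1] is hit by three of the nine indices [r]. *)
Lemma nine_cells (R : realType) (k l : int) :
  \sum_(r < 9) - (k + (r %% 3)%:Z - 1 == l)%:R = - 3 * (`|k - l| <= 1 :> int)%R%:R :> R.
Proof.
have E (r : nat) : (k + r%:Z - 1 == l) = (r%:Z == l - k + 1) by lia.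
have -> : (`|k - l| <= 1) = (0 <= l - k + 1 <= 2) by lia.
under eq_bigr => r _ do rewrite E.
rewrite !big_ord_recl big_ord0; case: (l - k + 1) => [[|[|[|e]]]|e] /=; try ring.
Qed.

Section Strategy.
Variables (R : realType) (n : nat) (x : 'I_n -> R) (theta : R) (g : 'I_n -> int).
Hypothesis xg : forall i, `|x i - grid theta (g i)| < 1.

(* [r %% 3] selects one of the cells [g j - 1], [g j], [g j + 1];
   [mxvec] encodes ['I_9 * 'I_n] as ['I_(9 * n)]. *)
Definition strategic_cell (k : 'I_(9 * n)) : int :=
  mxvec (\matrix_(r < 9, j < n) (g j + (r %% 3)%:Z - 1)) 0 k.

Definition strategy (k : 'I_(9 * n)) : R := grid theta (strategic_cell k).

Lemma strategic_excess (i : 'I_n) (k : int) :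
  (if `|x i - grid theta k| <= 1
   then 2 * `|grid theta k - grid theta (g i)| - 1 else 0) = - (k == g i)%:R :> R.
Proof.
case: eqVneq => [->|/(@grid_sep R theta)]; first by rewrite ltW// subrr normr0 mulr0 sub0r.
have := ler_distD (x i) (grid theta k) (grid theta (g i)).
rewrite (distrC (grid theta k) (x i)); have := xg i.
move=> ? ? ?; case: leP => [?|_]; [exfalso; lra|by rewrite oppr0].
Qed.

Lemma first_step (i : 'I_n) :
  `|hk_step x strategy i - grid theta (g i)| < 2^-1.
Proof.
apply: hk_step_near.
rewrite big_mkcond big_sumType /= sum_mxvec_index -big_split /=.
have nine (j : 'I_n) :
  \sum_(r < 9) (if inr (mxvec_index r j) \in neighbors (profile x strategy) (inl i)
      then 2 * `|strategy (mxvec_index r j) - grid theta (g i)| - 1 else 0)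
    = - 3 * (`|g j - g i| <= 1 :> int)%R%:R.
  rewrite -nine_cells; apply: eq_bigr => r _.
  by rewrite inE /= /strategy /strategic_cell mxvecE mxE strategic_excess.
under eq_bigr => j _ do rewrite nine inE /=.
(* Agent [i] weighs less than 1 and its own group contributes -3, which gives strictness; every
   other group, taken with its [j], need only be nonpositive. *)
rewrite (bigD1 i)//= !subrr !normr0 !ler01 /=.
rewrite -[ltRHS]addr0; apply: ltr_leD; first by have := xg i; lra.
apply: sumr_le0 => j _.
have := xg i; have := xg j.
have := ler_distD (x i) (x j) (grid theta (g i)).
rewrite (distrC (x j) (x i)) => tri xj xi.
have [xij|xij] := leP `|x i - x j| 1; last by case: (_ <= 1); rewrite /=; lra.
have [gij|gij] := eqVneq (g j) (g i).
  by rewrite gij subrr normr0 /=; move: xj; rewrite gij; lra.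
(* A visible [j] is within 1 + 1 of the centre, so it weighs less than 3; its group offsets this if
   its cell is adjacent. *)
suff -> : `|g j - g i| <= 1 by rewrite /=; lra.
suff : `|(g j - g i)%:~R : R| < 2 by rewrite -intr_norm -[2]/(2%:~R) ltr_int; lia.
move: xi xj xij; rewrite /grid rmorphB /= !(ltr_norml, ler_norml); lra.
Qed.

Lemma second_step (z : 'I_n -> R)
    (zg : forall i, `|z i - grid theta (g i)| < 2^-1) :
  converged (hk_step z strategy).
Proof.
pose key (a : agent n (9 * n)) : int :=
  match a with inl i => g i | inr k => strategic_cell k end.
have near a : `|profile z strategy a - grid theta (key a)| < 2^-1.
  by case: a => [i|k] /=; rewrite ?zg// subrr normr0 invr_gt0.
have NE a : neighbors (profile z strategy) a = [set b | key a == key b]%SET.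
  by apply/setP => b; rewrite !inE (near_grid_sep (near a) (near b)).
move=> i j; have [gij|gij] := eqVneq (g i) (g j).
  by left; rewrite /hk_step !NE /= gij.
(* Averaging within a cell keeps its agents near the centre, so distinct cells stay more than 1
   apart. *)
have hk k : `|hk_step z strategy k - grid theta (g k)| < 2^-1.
  apply: hk_step_near; rewrite NE (bigD1 (inl k)) ?inE//=.
  rewrite -[ltRHS]addr0; apply: ltr_leD; first by have := zg k; lra.
  by apply: sumr_le0 => b; rewrite inE => /andP[/eqP /= -> _]; have := near b; lra.
right; rewrite ltNge (near_grid_sep (hk i) (hk j)); exact/negP/negP.
Qed.
End Strategy.

Lemma f_le2 (R : realType) (n : nat) : (f R n (9 * n) <= 2%:E)%E.
Proof.
apply: ge_ereal_sup => _ [x _ <-].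
have [theta [g xg]] := grid_avoid x.
apply: ge_ereal_inf; exists (convergence_time x (fun=> strategy theta g)).
  by exists (fun=> strategy theta g).
apply: ereal_inf_lbound; exists 2%N => //=.
exact/second_step/first_step.
Qed.

Lemma f_ge1 (R : realType) (n m : nat) : (1 < n)%N -> (1%:E <= f R n m)%E.
Proof.
(* Opinions 0 and 1 differ but are exactly at the visibility threshold, so time 0 is excluded for
   every schedule. *)
move=> n1; pose x0 (i : 'I_n) : R := if i == 0%N :> nat then 0 else 1.
apply: le_ereal_sup_tmp; exists (optimal_convergence_time x0 m); first by exists x0.
apply: le_ereal_inf_tmp => _ [s _ <-].
apply: le_ereal_inf_tmp => _ [[|t] /= ct <-]; last by rewrite lee_fin ler1n.
have [] := ct (Ordinal (ltnW n1)) (Ordinal n1); rewrite /x0 /=.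
  by move/eqP; rewrite eq_sym oner_eq0.
by rewrite sub0r normrN normr1 ltxx.
Qed.

Theorem theorem14 (R : realType) :
  (forall n : nat, (1 <= n)%N -> (f R n (9 * n) <= 2%:E)%E) /\
  (exists (c C : R) (n0 : nat), 0 < c /\ 0 < C /\
     forall n : nat, (n0 <= n)%N ->
       (c%:E <= f R n (9 * n))%E /\ (f R n (9 * n) <= C%:E)%E).
Proof.
split=> [n _|]; first exact: f_le2.
exists 1, 2, 2%N; split; [exact: ltr01|split; [exact: ltr0n|]] => n n2.
by split; [exact: f_ge1|exact: f_le2].
Qed.
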